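(* Let $A$ be a Banach algebra. (i) Assume that $A$ is of type $(LM)$ or of type $(LM^\perp)$ and $m\in Z_t^{(l)}(A^{**})$. Then $m\in A$ if and only if $m\cdot A\subseteq A$. Therefore, $Z_t^{(l)}(A^{**})=A$ if and only if $Z_t^{(l)}(A^{**})\cdot A\subseteq A$. In particular, $Z_t^{(l)}(A^{**})=A$ if $A$ is a left ideal in $A^{**}$. (ii) Assume that $A$ is of type $(RM)$ or of type $(RM^\perp)$ and $m\in Z_t^{(r)}(A^{**})$. Then $m\in A$ if and only if $A\cdot m\subseteq A$. Therefore, $Z_t^{(r)}(A^{**})=A$ if and only if $A\cdot Z_t^{(r)}(A^{**})\subseteq A$. In particular, $Z_t^{(r)}(A^{**})=A$ if $A$ is a right ideal in $A^{**}$.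
   Context: Notation for a Banach algebra $A$. BAI means bounded (two-sided) approximate identity; WSC means weakly sequentially complete. $A^*$ is an $A$-bimodule via $\langle f\cdot a,b\rangle=\langle f,ab\rangle$, $\langle a\cdot f,b\rangle=\langle f,ba\rangle$; $A^*A=\{f\cdot a\}$, $AA^*=\{a\cdot f\}$. $A$ is identified with its canonical image in $A^{**}$. Left Arens product on $A^{**}$: $\langle m\cdot n,f\rangle=\langle m,n\cdot f\rangle$, $\langle n\cdot f,a\rangle=\langle n,f\cdot a\rangle$. Right Arens product: $\langle m\bigtriangleup n,f\rangle=\langle n,f\bigtriangleup m\rangle$, $\langle f\bigtriangleup m,a\rangle=\langle m,a\cdot f\rangle$. (Both products agree when one factor is in $A$.) $Z_t^{(l)}(A^{**})$ is the set of $m\in A^{**}$ such that $n\mapsto m\cdot n$ is weak$^*$-weak$^*$ continuous on $A^{**}$; $Z_t^{(r)}(A^{**})$ is the set of $m$ such that $n\mapsto n\bigtriangleup m$ is weak$^*$-weak$^*$ continuous. Types $(LM)$, $(RM)$. $LM(A)=\{T\in B(A):T(ab)=T(a)b\}$, $RM(A)=\{T\in B(A):T(ab)=aT(b)\}$. For $\mu\in LM(A)$ (resp. $RM(A)$), ''$\mu\in A$'' means $\mu$ is left (resp. right) multiplication by some element of $A$; for a closed subalgebra $C$ with $\mu(C)\subseteq C$, ''$\mu|_C\in C$'' means $\mu|_C$ is left (resp. right) multiplication on $C$ by an element of $C$. Condition $(L)$ for a Banach algebra $B$: $B$ has a BAI and there is a family $\{B_i\}$ of closed left ideals in $B$ such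 that (I) each $B_i$ is WSC with a sequential (not necessarily bounded) approximate identity; (II) for each $i$ there is a linear projection $p_i$ from $B$ onto $B_i$ with $p_i(xy)=p_i(x)y$ ($x\in B$, $y\in B_i$); (III) for any $\nu\in LM(B)$, if $\nu|_{B_i}\in B_i$ for all $i$, then $\nu\in B$. Condition $(R)$ is the mirror condition: closed right ideals $B_i$, $p_i(yx)=yp_i(x)$, and $RM(B)$ in place of $LM(B)$. A Banach algebra $A$ with a BAI is of type $(LM)$ (resp. $(RM)$) if for every $\mu\in LM(A)$ (resp. $RM(A)$) there is a closed subalgebra $B$ of $A$ satisfying $(L)$ (resp. $(R)$) such that (1) $f|_B\in B^*B$ for each $f\in A^*A$ (resp. $f|_B\in BB^*$ for each $f\in AA^*$); (2) $\mu(B)\subseteq B$, and $\mu\in A$ if $\mu|_B\in B$. Types $(LM^\perp)$, $(RM^\perp)$. A Banach algebra $A$ with a BAI is of type $(LM^\perp)$ (resp. $(RM^\perp)$) if there is a family $\{A_i\}$ of closed (two-sided) ideals in $A$ such that (I) each $A_i$ is WSC with a sequential BAI; (II) for each $i$ there is a bounded linear $A$-bimodule projection $p_i$ from $A$ onto $A_i$; (III) for any $m\in A^{**}$, if $p_i^{**}(m)\in A_i$ for all $i$, then $m\in A\oplus(AA^* )^\perp$ (resp. $m\in A\oplus(A^*A)^\perp$), where $p_i^{**}:A^{**}\to A_i^{**}$ and $\perp$ denotes the annihilator in $A^{**}$. *)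

(* Defs.v *)
From HB Require Import structures.
From mathcomp Require Import all_boot all_order all_algebra.
From mathcomp Require Import all_classical all_reals.
From mathcomp Require Import topology normedtype sequences.
From mathcomp Require Import complex.

Set Implicit Arguments.
Unset Strict Implicit.
Unset Printing Implicit Defensive.

Import Order.TTheory GRing.Theory Num.Theory.
Import numFieldNormedType.Exports.

Local Open Scope classical_set_scope.
Local Open Scope ring_scope.

Reserved Notation "x ** y" (at level 40, left associativity).
Reserved Notation "m '□' n" (at level 40, left associativity).
Reserved Notation "m '△' n" (at level 40, left associativity).

Definition real_or_complex (K : numFieldType) : Prop :=
  exists R : realType, K = R :> numFieldType \/ K = R[i] :> numFieldType.

(* Banach algebras are not assumed to be unital, so the product is not one of
   the ring structures of MathComp. *)
HB.mixin Record isBanachAlgebra (K : numFieldType) A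
    & CompleteNormedModule K A := {
  bmul : A -> A -> A;
  bmulA : associative bmul;
  bmulDl : left_distributive bmul +%R;
  bmulDr : right_distributive bmul +%R;
  bmulZl : forall (k : K) (a b : A), bmul (k *: a) b = k *: bmul a b;
  bmulZr : forall (k : K) (a b : A), bmul a (k *: b) = k *: bmul a b;
  bmul_norm : forall a b : A, `|bmul a b| <= `|a| * `|b|
}.

#[short(type="banachAlgType")]
HB.structure Definition BanachAlgebra (K : numFieldType) :=
  {A of isBanachAlgebra K A & CompleteNormedModule K A}.

Notation "x ** y" := (bmul x y) : ring_scope.

Record blin (K : numFieldType) (V W : normedModType K) := Blin {
  blin_fun :> {linear V -> W};
  blin_continuous : continuous blin_fun
}.

Section Dual.
Context {K : numFieldType} (V : normedModType K).

Definition dual_pred : {pred V -> K^o} :=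
  [pred f : V -> K^o | `[< linear f /\ continuous f >] ].

Record dual := Dual {
  dual_fun :> V -> K^o;
  dual_funP : dual_fun \in dual_pred
}.

HB.instance Definition _ := [isSub for dual_fun].
HB.instance Definition _ := [Choice of dual by <:].

Lemma dual_submod_closed : submod_closed dual_pred.
Proof.
split.
  apply/asboolP; split; last exact: cst_continuous.
  by move=> k x y /=; rewrite scaler0 addr0.
move=> a f g /asboolP[lf cf] /asboolP[lg cg]; apply/asboolP; split.
  move=> k x y /=; rewrite !fctE lf lg !scalerDr !scalerA mulrC.
  by rewrite addrACA.
move=> x; apply: (@continuousD _ K^o); last exact: cg.
by apply: (@continuousZr _ K^o); exact: cf.
Qed.

HB.instance Definition _ := GRing.isSubmodClosed.Build _ _ dual_pred
  dual_submod_closed.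
HB.instance Definition _ := [SubChoice_isSubLmodule of dual by <:].

Lemma dual_linear (f : dual) : linear f.
Proof. by case: f => f /= /asboolP[]. Qed.

Lemma dual_continuous (f : dual) : continuous f.
Proof. by case: f => f /= /asboolP[]. Qed.

Lemma dualP (f g : dual) : (forall x, f x = g x) -> f = g.
Proof. by move=> fg; apply/val_inj/funext. Qed.

Lemma dual_linE k (f g : dual) x : (k *: f + g : dual) x = k *: f x + g x.
Proof. by []. Qed.

(* [dual_bound f c] says that the norm of the functional [f] is at most [c]. *)
Definition dual_bound (f : dual) (c : K) : Prop :=
  0 <= c /\ forall x, `|f x| <= c * `|x|.

Lemma dual_boundW (f : dual) : exists c, dual_bound f c.
Proof.
pose g : {linear V -> K^o} :=
  HB.pack (f : V -> K^o) (GRing.isLinear.Build _ _ _ _ _ (dual_linear f)).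
have /linear_boundedP /pinfty_ex_gt0 [c c0 fc] : bounded_near g (nbhs 0).
  by apply/linear_bounded_continuous; exact: dual_continuous.
by exists c; split; [exact: ltW | exact: fc].
Qed.

Lemma bounded_dual_pred (g : V -> K^o) c : linear g ->
  (forall x, `|g x| <= c * `|x|) -> g \in dual_pred.
Proof.
move=> lg gc; apply/asboolP; split => //.
pose h : {linear V -> K^o} :=
  HB.pack (g : V -> K^o) (GRing.isLinear.Build _ _ _ _ _ lg).
apply: (@bounded_linear_continuous _ _ _ h); apply/ex_bound; exists `|c|.
apply/nbhs_norm0P; exists 1 => //= x /= x1.
have [->|x0] := eqVneq x 0.
  by rewrite (_ : g 0 = 0) ?normr0//; exact: (linear0 h).
have xp : 0 < `|x| by rewrite normr_gt0.
have cr : 0 <= c by rewrite -(pmulr_lge0 _ xp); exact: le_trans (gc x).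
rewrite (le_trans (gc x))// (ger0_norm cr) -[leRHS]mulr1.
by rewrite ler_wpM2l// ltW.
Qed.

(* The bidual consists of the linear functionals on the dual that are bounded
   for the dual norm. *)
Definition bidual_pred : {pred dual -> K^o} :=
  [pred m : dual -> K^o | `[< linear m /\
     exists C : K, forall f c, dual_bound f c -> `|m f| <= C * c >] ].

Record bidual := Bidual {
  bidual_fun :> dual -> K^o;
  bidual_funP : bidual_fun \in bidual_pred
}.

HB.instance Definition _ := [isSub for bidual_fun].
HB.instance Definition _ := [Choice of bidual by <:].

Lemma bidual_submod_closed : submod_closed bidual_pred.
Proof.
split.
  apply/asboolP; split; first by move=> k x y /=; rewrite scaler0 addr0.
  by exists 0 => f c _; rewrite mul0r normr0.
move=> a m n /asboolP[lm [C hC]] /asboolP[ln [D hD]]; apply/asboolP; split.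
  move=> k x y /=; rewrite !fctE lm ln !scalerDr !scalerA mulrC.
  by rewrite addrACA.
exists (`|a| * C + D) => f c fc; rewrite !fctE (le_trans (ler_normD _ _))//.
rewrite mulrDl lerD ?hD// normrM -mulrA ler_wpM2l//.
exact: hC.
Qed.

HB.instance Definition _ := GRing.isSubmodClosed.Build _ _ bidual_pred
  bidual_submod_closed.
HB.instance Definition _ := [SubChoice_isSubLmodule of bidual by <:].

Lemma bidual_linear (m : bidual) : linear m.
Proof. by case: m => m /= /asboolP[]. Qed.

Lemma bidual_bounded (m : bidual) :
  exists C : K, forall f c, dual_bound f c -> `|m f| <= C * c.
Proof. by case: m => m /= /asboolP[]. Qed.

Lemma bidual_boundedW (m : bidual) : exists2 C : K, 0 <= C &
  forall f c, dual_bound f c -> `|m f| <= C * c.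
Proof.
have [C mC] := bidual_bounded m; exists `|C| => // f c fc.
have [c0 _] := fc; rewrite (le_trans (mC _ _ fc))//.
have /le_trans /(_ (mC _ _ fc)) := normr_ge0 (m f).
move: c0; rewrite le_eqVlt => /predU1P[<-|c0]; first by rewrite !mulr0.
by rewrite pmulr_lge0// => C0; rewrite ger0_norm.
Qed.

Lemma bidualP (m n : bidual) : (forall f, m f = n f) -> m = n.
Proof. by move=> mn; apply/val_inj/funext. Qed.

(* The topology put on the bidual is the weak* topology (pointwise convergence
   on the dual), not the norm topology. *)
HB.instance Definition _ := Topological.copy bidual
  (initial_topology (bidual_fun : bidual -> {ptws dual -> K^o})).

Lemma to_bidual_subproof (x : V) : (fun f : dual => f x) \in bidual_pred.
Proof.
apply/asboolP; split => //.
by exists `|x| => f c [_ fc]; rewrite mulrC.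
Qed.

Definition to_bidual (x : V) : bidual := Bidual (to_bidual_subproof x).

(* Weakly Cauchy sequences are weakly convergent. *)
Definition WSC : Prop :=
  forall x : nat -> V,
    (forall f : dual, cauchy (f (x n) @[n --> \oo])) ->
    exists l : V, forall f : dual, f (x n) @[n --> \oo] --> f l.

End Dual.

Section Adjoint.
Context {K : numFieldType} {V W : normedModType K} (T : blin V W).

Lemma adjoint_subproof (f : dual W) : (fun x => f (T x)) \in @dual_pred K V.
Proof.
apply/asboolP; split; first by move=> k x y; rewrite linearP dual_linear.
move=> x; apply: continuous_comp; first exact: blin_continuous.
exact: dual_continuous.
Qed.

Definition adjoint (f : dual W) : dual V := Dual (adjoint_subproof f).

Lemma biadjoint_subproof (m : bidual V) :
  (fun f => m (adjoint f)) \in @bidual_pred K W.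
Proof.
apply/asboolP; split.
  by move=> k f g; rewrite -bidual_linear; congr (m _); exact: dualP.
have /linear_boundedP /pinfty_ex_gt0 [t t0 Tt] : bounded_near T (nbhs 0).
  by apply/linear_bounded_continuous; exact: blin_continuous.
have [C mC] := bidual_bounded m.
exists (C * t) => f c [c0 fc]; rewrite -mulrA.
apply: mC; split; first by rewrite mulr_ge0// ltW.
move=> x; rewrite (le_trans (fc _))// (mulrC t) -mulrA.
by rewrite ler_wpM2l.
Qed.

Definition biadjoint (m : bidual V) : bidual W := Bidual (biadjoint_subproof m).

End Adjoint.

(* In the usual notation, [actr f a] is f.a, [actl a f] is a.f, [bactl n f] is
   n.f and [bactr f m] is f △ m; [arensl] and [arensr] are the left and right
   Arens products. *)
Section ArensProducts.
Context {K : numFieldType} {A : banachAlgType K}.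
Implicit Types (a b : A) (f : dual A) (m n : bidual A).

Lemma bmul_linearl b : linear (fun a => a ** b).
Proof. by move=> k x y; rewrite bmulDl bmulZl. Qed.

Lemma bmul_linearr a : linear (fun b => a ** b).
Proof. by move=> k x y; rewrite bmulDr bmulZr. Qed.

Lemma dual_bound_actr f a c : dual_bound f c ->
  forall b, `|f (a ** b)| <= c * `|a| * `|b|.
Proof.
move=> [c0 fc] b; rewrite (le_trans (fc _))// -mulrA.
by rewrite ler_wpM2l// bmul_norm.
Qed.

Lemma dual_bound_actl f a c : dual_bound f c ->
  forall b, `|f (b ** a)| <= c * `|a| * `|b|.
Proof.
move=> [c0 fc] b; rewrite (le_trans (fc _))// -mulrA.
by rewrite ler_wpM2l// mulrC bmul_norm.
Qed.

Lemma actr_subproof f a : (fun b => f (a ** b)) \in @dual_pred K A.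
Proof.
have [c fc] := dual_boundW f.
apply: (bounded_dual_pred _ (dual_bound_actr a fc)).
by move=> k x y; rewrite bmul_linearr dual_linear.
Qed.

Definition actr f a : dual A := Dual (actr_subproof f a).

Lemma actl_subproof a f : (fun b => f (b ** a)) \in @dual_pred K A.
Proof.
have [c fc] := dual_boundW f.
apply: (bounded_dual_pred _ (dual_bound_actl a fc)).
by move=> k x y; rewrite bmul_linearl dual_linear.
Qed.

Definition actl a f : dual A := Dual (actl_subproof a f).

Lemma bactl_subproof n f : (fun a => n (actr f a)) \in @dual_pred K A.
Proof.
have [c fc] := dual_boundW f; have [C nC] := bidual_bounded n.
apply: (@bounded_dual_pred _ _ _ (C * c)).
  move=> k x y /=; rewrite -bidual_linear; congr (n _).
  by apply: dualP => b /=; rewrite bmul_linearl dual_linear.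
move=> a; rewrite -mulrA; apply: nC; split; last exact: dual_bound_actr.
by case: fc => c0 _; rewrite mulr_ge0.
Qed.

Definition bactl n f : dual A := Dual (bactl_subproof n f).

Lemma bactr_subproof f m : (fun a => m (actl a f)) \in @dual_pred K A.
Proof.
have [c fc] := dual_boundW f; have [C mC] := bidual_bounded m.
apply: (@bounded_dual_pred _ _ _ (C * c)).
  move=> k x y /=; rewrite -bidual_linear; congr (m _).
  by apply: dualP => b /=; rewrite bmul_linearr dual_linear.
move=> a; rewrite -mulrA; apply: mC; split; last exact: dual_bound_actl.
by case: fc => c0 _; rewrite mulr_ge0.
Qed.

Definition bactr f m : dual A := Dual (bactr_subproof f m).

Lemma arensl_subproof m n : (fun f => m (bactl n f)) \in @bidual_pred K A.
Proof.
have [M mM] := bidual_bounded m; have [C C0 nC] := bidual_boundedW n.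
apply/asboolP; split.
  move=> k f g; rewrite -bidual_linear; congr (m _); apply: dualP => a.
  by rewrite dual_linE /= -bidual_linear; congr (n _); apply: dualP.
exists (M * C) => f c [c0 fc]; rewrite -mulrA; apply: mM.
split; first exact: mulr_ge0.
move=> a; rewrite -mulrA; apply: nC; split; first exact: mulr_ge0.
exact: dual_bound_actr.
Qed.

Definition arensl m n : bidual A := Bidual (arensl_subproof m n).

Lemma arensr_subproof m n : (fun f => n (bactr f m)) \in @bidual_pred K A.
Proof.
have [M mM] := bidual_bounded n; have [C C0 nC] := bidual_boundedW m.
apply/asboolP; split.
  move=> k f g; rewrite -bidual_linear; congr (n _); apply: dualP => a.
  by rewrite dual_linE /= -bidual_linear; congr (m _); apply: dualP.
exists (M * C) => f c [c0 fc]; rewrite -mulrA; apply: mM.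
split; first exact: mulr_ge0.
move=> a; rewrite -mulrA; apply: nC; split; first exact: mulr_ge0.
exact: dual_bound_actl.
Qed.

Definition arensr m n : bidual A := Bidual (arensr_subproof m n).

End ArensProducts.

Notation "m '□' n" := (arensl m n) : ring_scope.
Notation "m '△' n" := (arensr m n) : ring_scope.

Section Sets.
Context {K : numFieldType} (A : banachAlgType K).

Definition canonical_image : set (bidual A) := range (@to_bidual K A).

(* The sets A^* A and A A^* of all products; no linear span is taken. *)
Definition dualA : set (dual A) := [set f | exists g a, f = actr g a].
Definition Adual : set (dual A) := [set f | exists a g, f = actl a g].

Definition annihilator (S : set (dual A)) : set (bidual A) :=
  [set m | forall f, S f -> m f = 0].

(* Continuity refers to the weak* topology of the bidual. *)
Definition Zl : set (bidual A) := [set m | continuous (fun n => m □ n)].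
Definition Zr : set (bidual A) := [set m | continuous (fun n => n △ m)].

End Sets.

Arguments Adual {K} A.
Arguments dualA {K} A.
Arguments canonical_image {K} A.
Arguments Zl {K} A.
Arguments Zr {K} A.

Section ApproximateIdentities.
Context {K : numFieldType} (A : banachAlgType K).

Definition directed (D : Type) (le : D -> D -> Prop) : Prop :=
  [/\ inhabited D, (forall d, le d d),
      (forall d1 d2 d3, le d1 d2 -> le d2 d3 -> le d1 d3) &
      (forall d1 d2, exists d3, le d1 d3 /\ le d2 d3)].

(* The filter of tails of a directed set: convergence along it is convergence
   of nets. *)
Definition tails (D : Type) (le : D -> D -> Prop) : set_system D :=
  filter_from setT (fun d0 => [set d | le d0 d]).

Definition has_BAI : Prop :=
  exists (D : Type) (le : D -> D -> Prop) (e : D -> A),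
    [/\ directed le, (exists M : K, forall d, `|e d| <= M),
        (forall a, e d ** a @[d --> tails le] --> a) &
        (forall a, a ** e d @[d --> tails le] --> a)].

Definition is_seq_AI (e : nat -> A) : Prop :=
  (forall a, e n ** a @[n --> \oo] --> a) /\
  (forall a, a ** e n @[n --> \oo] --> a).

Definition has_seq_AI : Prop := exists e, is_seq_AI e.

Definition has_seq_BAI : Prop :=
  exists e, is_seq_AI e /\ exists M : K, forall n, `|e n| <= M.

End ApproximateIdentities.

Record closed_subalg (K : numFieldType) (A : banachAlgType K) := ClosedSubalg {
  carrier : set A;
  csa_submod : submod_closed [pred x | x \in carrier];
  csa_mul : forall x y, carrier x -> carrier y -> carrier (x ** y);
  csa_closed : closed carrier
}.

Section ClosedSubalgebra.
Context {K : numFieldType} {A : banachAlgType K} (B : closed_subalg A).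

Definition csa_pred : {pred A} := [pred x | x \in carrier B].

Record csa := Csa { csa_val : A; csa_valP : csa_val \in csa_pred }.

HB.instance Definition _ := [isSub for csa_val].
HB.instance Definition _ := [Choice of csa by <:].
HB.instance Definition _ := GRing.isSubmodClosed.Build _ _ csa_pred
  (csa_submod B).
HB.instance Definition _ := [SubChoice_isSubLmodule of csa by <:].

Let norm (x : csa) : K := `|csa_val x|.

Let ler_normD x y : norm (x + y) <= norm x + norm y.
Proof. exact: Num.Theory.ler_normD. Qed.

Let normrZ (l : K) x : norm (l *: x) = `|l| * norm x.
Proof. exact: normed_module.normrZ. Qed.

Let normr0_eq0 x : norm x = 0 -> x = 0.
Proof. by move=> /Num.Theory.normr0_eq0 x0; exact: val_inj. Qed.

Let normrMn x n : norm (x *+ n) = norm x *+ n.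
Proof. by rewrite /norm -normrMn -[in RHS]scaler_nat -scaler_nat. Qed.

Let normrN x : norm (- x) = norm x.
Proof. exact: Num.Theory.normrN. Qed.

HB.instance Definition _ := Num.Zmodule_isNormed.Build
  K csa ler_normD normr0_eq0 normrMn normrN.
HB.instance Definition _ := PseudoMetric.copy csa (pseudoMetric_normed csa).
HB.instance Definition _ := isPointed.Build csa 0.
HB.instance Definition _ := NormedZmod_PseudoMetric_eq.Build K csa erefl.
HB.instance Definition _ :=
  PseudoMetricNormedZmod_Lmodule_isNormedModule.Build K csa normrZ.

Lemma csa_normE (x : csa) : `|x| = `|csa_val x|.
Proof. by []. Qed.

Lemma csa_val_linear : linear csa_val.
Proof. by []. Qed.

HB.instance Definition _ :=
  GRing.isLinear.Build K csa A _ csa_val csa_val_linear.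

Lemma csa_val_continuous : continuous csa_val.
Proof.
apply: bounded_linear_continuous; apply/linear_boundedP.
near=> r => x; rewrite -csa_normE -[leLHS]mul1r ler_wpM2r//.
Unshelve. all: by end_near. Qed.

Definition csa_incl : blin csa A := Blin csa_val_continuous.

Let csa_complete (F : set_system csa) : ProperFilter F -> cauchy F -> cvg F.
Proof.
move=> FF /cauchy_ballP Fc.
have vc : cauchy (csa_val @ F).
  apply/cauchy_ballP => e e0; have [[P Q] /= [FP FQ] PQ] := Fc e e0.
  exists (csa_val @` P, csa_val @` Q) => /=.
    by split; [apply: filterS FP => x Px|apply: filterS FQ => x Qx]; exists x.
  move=> [_ _] [/= [x Px <-] [y Qy <-]]; have := PQ (x, y) (conj Px Qy).
  by rewrite /= -!ball_normE /ball_ /= csa_normE linearB.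
have vl : csa_val @ F --> lim (csa_val @ F).
  by apply: (@cauchy_cvg A (csa_val @ F)); exact: vc.
set l := lim _ in vl.
have Bl : carrier B l.
  apply: (@csa_closed _ _ B) => U /vl Ul.
  have [x Ux] := @filter_ex _ F _ (csa_val @^-1` U) Ul.
  by exists (csa_val x); split => //; apply: set_mem; exact: (csa_valP x).
have lP : l \in csa_pred by rewrite !inE.
apply/cvg_ex; exists (Csa lP); apply/fcvgrPdist_lt => e e0.
move/cvgrPdist_lt : vl => /(_ e e0).
by apply: filterS => x; rewrite csa_normE linearB.
Qed.
HB.instance Definition _ := Uniform_isComplete.Build csa csa_complete.

Lemma csa_bmul_subproof (x y : csa) : csa_val x ** csa_val y \in csa_pred.
Proof.
by rewrite !inE; apply: csa_mul; apply: set_mem; exact: csa_valP.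
Qed.

Let csa_bmul (x y : csa) : csa := Csa (csa_bmul_subproof x y).

Let csa_bmulA : associative csa_bmul.
Proof. by move=> x y z; apply: val_inj; exact: bmulA. Qed.

Let csa_bmulDl : left_distributive csa_bmul +%R.
Proof. by move=> x y z; apply: val_inj; exact: bmulDl. Qed.

Let csa_bmulDr : right_distributive csa_bmul +%R.
Proof. by move=> x y z; apply: val_inj; exact: bmulDr. Qed.

Let csa_bmulZl (k : K) x y : csa_bmul (k *: x) y = k *: csa_bmul x y.
Proof. by apply: val_inj; exact: bmulZl. Qed.

Let csa_bmulZr (k : K) x y : csa_bmul x (k *: y) = k *: csa_bmul x y.
Proof. by apply: val_inj; exact: bmulZr. Qed.

Let csa_bmul_norm x y : `|csa_bmul x y| <= `|x| * `|y|.
Proof. exact: bmul_norm. Qed.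

HB.instance Definition _ := isBanachAlgebra.Build K csa
  csa_bmulA csa_bmulDl csa_bmulDr csa_bmulZl csa_bmulZr csa_bmul_norm.

Lemma csa_bmulE (x y : csa) : csa_val (x ** y) = csa_val x ** csa_val y.
Proof. by []. Qed.

End ClosedSubalgebra.

Section Multipliers.
Context {K : numFieldType} {A : banachAlgType K}.

Definition LM (T : blin A A) : Prop := forall a b, T (a ** b) = T a ** b.
Definition RM (T : blin A A) : Prop := forall a b, T (a ** b) = a ** T b.

Definition is_lmult (T : A -> A) : Prop := exists a, forall x, T x = a ** x.
Definition is_rmult (T : A -> A) : Prop := exists a, forall x, T x = x ** a.

(* T(C) `<=` C follows, since C is closed under the product. *)
Definition restr_is_lmult (T : A -> A) (C : closed_subalg A) : Prop :=
  exists c, carrier C c /\ forall x, carrier C x -> T x = c ** x.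
Definition restr_is_rmult (T : A -> A) (C : closed_subalg A) : Prop :=
  exists c, carrier C c /\ forall x, carrier C x -> T x = x ** c.

Definition left_ideal (J : closed_subalg A) : Prop :=
  forall x y, carrier J y -> carrier J (x ** y).
Definition right_ideal (J : closed_subalg A) : Prop :=
  forall x y, carrier J y -> carrier J (y ** x).

End Multipliers.

Section Types.
Context {K : numFieldType}.
Implicit Types A B : banachAlgType K.

Definition condition_L B : Prop :=
  has_BAI B /\
  exists (I : Type) (J : I -> closed_subalg B),
    [/\ (forall i, left_ideal (J i)),
        (forall i, WSC (csa (J i)) /\ has_seq_AI (csa (J i))),
        (forall i, exists p : {linear B -> csa (J i)},
           (forall y, p (csa_val y) = y) /\
           (forall x y, p (x ** csa_val y) = p x ** y)) &
        (forall nu : blin B B, LM nu ->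
           (forall i, restr_is_lmult nu (J i)) -> is_lmult nu)].

Definition condition_R B : Prop :=
  has_BAI B /\
  exists (I : Type) (J : I -> closed_subalg B),
    [/\ (forall i, right_ideal (J i)),
        (forall i, WSC (csa (J i)) /\ has_seq_AI (csa (J i))),
        (forall i, exists p : {linear B -> csa (J i)},
           (forall y, p (csa_val y) = y) /\
           (forall x y, p (csa_val y ** x) = y ** p x)) &
        (forall nu : blin B B, RM nu ->
           (forall i, restr_is_rmult nu (J i)) -> is_rmult nu)].

Definition type_LM A : Prop :=
  has_BAI A /\
  forall mu : blin A A, LM mu -> exists B : closed_subalg A,
    [/\ condition_L (csa B),
        (forall f, dualA A f -> dualA (csa B) (adjoint (csa_incl B) f)),
        (forall x, carrier B x -> carrier B (mu x)) &
        (restr_is_lmult mu B -> is_lmult mu)].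

Definition type_RM A : Prop :=
  has_BAI A /\
  forall mu : blin A A, RM mu -> exists B : closed_subalg A,
    [/\ condition_R (csa B),
        (forall f, Adual A f -> Adual (csa B) (adjoint (csa_incl B) f)),
        (forall x, carrier B x -> carrier B (mu x)) &
        (restr_is_rmult mu B -> is_rmult mu)].

(* The common part of the types (LM^perp) and (RM^perp): S is the set whose
   annihilator occurs in the last condition. *)
Definition type_perp A (S : set (dual A)) : Prop :=
  has_BAI A /\
  exists (I : Type) (J : I -> closed_subalg A)
         (p : forall i, blin A (csa (J i))),
    [/\ (forall i, left_ideal (J i) /\ right_ideal (J i)),
        (forall i, WSC (csa (J i)) /\ has_seq_BAI (csa (J i))),
        (forall i y, p i (csa_val y) = y),
        (forall i a x, csa_val (p i (a ** x)) = a ** csa_val (p i x) /\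
                       csa_val (p i (x ** a)) = csa_val (p i x) ** a) &
        (forall m : bidual A,
           (forall i, canonical_image (csa (J i)) (biadjoint (p i) m)) ->
           exists a n, annihilator S n /\ m = to_bidual a + n)].

Definition type_LMperp A : Prop := type_perp (Adual A).
Definition type_RMperp A : Prop := type_perp (dualA A).

End Types.

(* Main.v *)
(* A functional m of the topological centre with m.A inside A induces a
   multiplier mu with <m, a.f> = <f, mu a>.  If mu is multiplication by c, then
   evaluating along the approximate identity of A gives m = c, by the weak*
   continuity of m.

   Type (LM): each projection p_i satisfies p_i(x) y = x y on B_i, so p_i(x) is
   the limit of x e_n for the approximate identity (e_n) of B_i, and
   Banach-Steinhaus makes both p_i and (e_n) bounded.  For g in B_i^*, extend
   g o p_i to f in A^* by Hahn-Banach.  Then <f, a e_n> converges for every a,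
   because f.a restricts to B^* B; since m is in the topological centre,
   <g, p_i(mu(e_n))> = <m, e_n.f> converges.  Weak sequential completeness gives
   a weak limit c in B_i of p_i(mu(e_n)), and p_i(mu(e_n)) x = mu(e_n x) shows
   that mu is multiplication by c on B_i.

   Type (LM^perp): the same argument with f = g o p_i gives p_i^**(m) = c. *)

From HB Require Import structures.
Require Import Defs.
From mathcomp Require Import all_boot all_order all_algebra.
From mathcomp Require Import all_classical all_reals.
From mathcomp Require Import topology normedtype sequences.
From mathcomp Require Import complex lra.

Set Implicit Arguments.
Unset Strict Implicit.
Unset Printing Implicit Defensive.

Import Order.TTheory GRing.Theory Num.Theory.
Import numFieldNormedType.Exports.

Local Open Scope classical_set_scope.
Local Open Scope ring_scope.

Lemma linear_fun0 (K : pzRingType) (V W : lmodType K) (f : V -> W) :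
  linear f -> f 0 = 0.
Proof. by move=> /(_ (-1) 0 0); rewrite scaler0 addr0 scaleN1r addNr. Qed.

(** * Hahn-Banach extension below a sublinear functional on a real space *)

Section HahnBanach.
Variables (R : realType) (V : lmodType R) (p : V -> R).
Hypothesis pD : forall x y, p (x + y) <= p x + p y.
Hypothesis pZ : forall k x, 0 <= k -> p (k *: x) = k * p x.

(* A linear functional on a subspace of V is encoded by its graph; domination
   by p makes the graph functional. *)
Definition dominated_graph (G : set (V * R)) : Prop :=
  [/\ G 0, (forall k u v, G u -> G v -> G (k *: u + v)) &
      (forall u, G u -> u.2 <= p u.1)].

Lemma dominated_graph_fun G x a b : dominated_graph G ->
  G (x, a) -> G (x, b) -> a = b.
Proof.
have p0 : p 0 = 0 by rewrite -(scale0r 0) pZ// mul0r.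
move=> [_ GL Gp] Ga Gb.
have le c d : G (x, c) -> G (x, d) -> d <= c.
  move=> Gc Gd; have /Gp /= := GL (-1) _ _ Gc Gd.
  by rewrite !scaleN1r addNr p0 addrC subr_le0.
by apply/eqP; rewrite eq_le !le.
Qed.

(** The value [a] at [x0] has to lie between all [v.2 - p (v.1 - x0)] and all [p (v.1 + x0) - v.2].
    Subadditivity puts the former below the latter, and [a] is the supremum of the former. *)
Lemma dominated_graph_extend G x0 : dominated_graph G ->
  exists a, dominated_graph
    [set u | exists t v, G v /\ u = (v.1 + t *: x0, v.2 + t * a)].
Proof.
move=> [G0 GL Gp].
have GN u v : G u -> G v -> G (u - v).
  by move=> Gu Gv; rewrite addrC -scaleN1r; exact: GL.
have GZ k u : G u -> G (k *: u).
  by move=> Gu; rewrite -[k *: u]addr0; exact: GL.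
pose S := [set v.2 - p (v.1 - x0) | v in G].
have Sub v : G v -> ubound S (p (v.1 + x0) - v.2).
  move=> Gv _ [u Gu <-]; rewrite lerBrDr addrAC lerBlDr.
  have := GL 1 _ _ Gu Gv; rewrite scale1r => /Gp/= /le_trans; apply.
  have -> : u.1 + v.1 = (v.1 + x0) + (u.1 - x0).
    by rewrite addrACA addrN addr0 addrC.
  exact: pD.
have S0 : S !=set0 by exists (0 - p (0 - x0)), 0.
have supS : has_sup S by split => //; exists (p (0 + x0) - 0); exact: (Sub 0).
pose a := sup S.
have aP v : G v -> v.2 + a <= p (v.1 + x0).
  by move=> Gv; rewrite addrC -lerBrDr; exact: ge_sup (Sub v Gv).
have aN v : G v -> v.2 - a <= p (v.1 - x0).
  move=> Gv; rewrite lerBlDl -lerBlDr; apply: ub_le_sup; last by exists v.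
  by case: supS.
exists a; split.
- by exists 0, 0; split => //; rewrite scale0r mul0r !addr0.
- move=> k _ _ [t [u [Gu ->]]] [s [v [Gv ->]]].
  exists (k * t + s), (k *: u + v); split; first exact: GL.
  congr pair => /=; first by rewrite scalerDr scalerDl scalerA addrACA.
  by rewrite /GRing.scale/= mulrDr mulrDl mulrA addrACA.
- move=> _ [t [v [Gv ->]]] /=; have [t0|t0|->] := ltgtP t 0; last first.
  + by rewrite scale0r mul0r !addr0; exact: Gp.
  + have := aP _ (GZ t^-1 _ Gv); rewrite -(ler_pM2l t0).
    rewrite mulrDr -(pZ _ (ltW t0)) scalerDr /= scalerA.
    rewrite -[t^-1 *: v.2]/(t^-1 * v.2) mulrA mulfV ?gt_eqF//.
    by rewrite mul1r scale1r.
  + have nt0 : 0 < - t by rewrite oppr_gt0.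
    have := aN _ (GZ (- t)^-1 _ Gv); rewrite -(ler_pM2l nt0).
    rewrite mulrBr -(pZ _ (ltW nt0)) scalerBr /= scalerA.
    rewrite -[_^-1 *: v.2]/(_^-1 * v.2) mulrA mulfV ?gt_eqF//.
    by rewrite mul1r scale1r mulNr scaleNr !opprK.
Qed.

Theorem hahn_banach G : dominated_graph G ->
  exists F : V -> R, [/\ linear (F : V -> R^o), (forall u, G u -> F u.1 = u.2) &
    (forall x, F x <= p x)].
Proof.
(* [Zorn_bigcup] also asks about the empty chain, so the order is put on the sets added to [G]. *)
move=> domG; pose P H := dominated_graph (G `|` H).
have [C CP Ctot|M [PM Mmax]] := @Zorn_bigcup _ P.
  have sub X : C X -> G `|` X `<=` G `|` \bigcup_(Y in C) Y.
    by move=> CX; apply: setUS; exact: bigcup_sup.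
  have both u v : (G `|` \bigcup_(Y in C) Y) u -> (G `|` \bigcup_(Y in C) Y) v ->
      exists2 H, dominated_graph H /\ H `<=` G `|` \bigcup_(Y in C) Y &
        H u /\ H v.
    move=> [Gu|[X CX Xu]] [Gv|[Y CY Yv]].
    - by exists G => //; split => // w; left.
    - by exists (G `|` Y); [split; [exact: CP|exact: sub]|split; [left|right]].
    - by exists (G `|` X); [split; [exact: CP|exact: sub]|split; [right|left]].
    - have [XY|YX] := Ctot _ _ CX CY.
      + exists (G `|` Y); first by split; [exact: CP|exact: sub].
        by split; right => //; exact: XY.
      + exists (G `|` X); first by split; [exact: CP|exact: sub].
        by split; right => //; exact: YX.
  split.
  - by left; case: domG.
  - by move=> k u v Gu Gv; have [H [[_ HL _] HS] [Hu Hv]] := both u v Gu Gv;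
       exact/HS/HL.
  - by move=> u Gu; have [H [[_ _ Hp] _] [Hu _]] := both u u Gu Gu; exact: Hp.
(* A maximal [M] already contains its extension in the direction [x], which makes the graph
   total. *)
have tot x : exists a, (G `|` M) (x, a).
  have [a Ha] := dominated_graph_extend x PM; set H := mkset _ in Ha.
  have MH : G `|` M `<=` H.
    move=> u Mu; exists 0, u; split => //.
    by rewrite scale0r mul0r !addr0; case: u {Mu}.
  have [HM|nHM] := pselect (H `<=` M).
    exists a; right; apply: HM; exists 1, 0; split; first by case: PM.
    by rewrite scale1r mul1r !add0r.
  exfalso; apply: (Mmax H); last first.
    rewrite /P setUC (_ : H `|` G = H)//.
    by apply/seteqP; split => [u [//|Gu]|u]; [apply: MH; left|left].
  by split; [apply: subset_trans MH; exact: subsetUr|].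
have [F FP] := choice tot.
have [_ ML Mp] := PM.
exists F; split.
- move=> k x y; apply: (dominated_graph_fun PM (FP _)).
  exact: (ML _ _ _ (FP x) (FP y)).
- by move=> [x a] Gx; apply: (dominated_graph_fun PM (FP _)); left.
- by move=> x; exact: (Mp _ (FP x)).
Qed.

End HahnBanach.

(** * Complex normed spaces regarded as real ones *)

Section Realified.
Variables (R : realType) (V : normedModType R[i]).

(** A copy of the type, so that the real structure does not clash with the complex one carried by
    [V]. *)
Definition realified : Type := V.

HB.instance Definition _ := GRing.Zmodule.on realified.

Let scale (r : R) (x : realified) : realified := r%:C%C *: (x : V).

Let scaleA a b x : scale a (scale b x) = scale (a * b) x.
Proof. by rewrite /scale scalerA rmorphM. Qed.

Let scale1 : left_id 1 scale.
Proof. by move=> x; rewrite /scale rmorph1 scale1r. Qed.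

Let scaleDr : right_distributive scale +%R.
Proof. by move=> a x y; exact: scalerDr. Qed.

Let scaleDl x : {morph scale^~ x : a b / a + b}.
Proof. by move=> a b; rewrite /scale rmorphD scalerDl. Qed.

HB.instance Definition _ := GRing.Zmodule_isLmodule.Build R realified
  scaleA scale1 scaleDr scaleDl.

Let norm (x : realified) : R := complex.Re `|x : V|.

Lemma realified_normE (x : V) : (norm x)%:C%C = `|x|.
Proof. exact/RRe_real/normr_real. Qed.

Let ler_normD x y : norm (x + y) <= norm x + norm y.
Proof.
by rewrite -lecR rmorphD/= !realified_normE; exact: (@Num.Theory.ler_normD _ V).
Qed.

Let normr0_eq0 x : norm x = 0 -> x = 0.
Proof.
move=> x0; apply: (@Num.Theory.normr0_eq0 _ V).
by rewrite -realified_normE x0.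
Qed.

Let normrZ (r : R) x : norm (r *: x) = `|r| * norm x.
Proof.
apply: complexI; rewrite rmorphM/= !realified_normE normrZ; congr (_ * _).
by rewrite normc_def/= expr0n addr0 sqrtr_sqr.
Qed.

Let normrMn x n : norm (x *+ n) = norm x *+ n.
Proof. by rewrite -scaler_nat normrZ normr_nat mulr_natl. Qed.

Let normrN x : norm (- x) = norm x.
Proof. by rewrite -scaleN1r normrZ normrN1 mul1r. Qed.

HB.instance Definition _ := Num.Zmodule_isNormed.Build
  R realified ler_normD normr0_eq0 normrMn normrN.
HB.instance Definition _ := PseudoMetric.copy realified
  (pseudoMetric_normed realified).
HB.instance Definition _ := isPointed.Build realified 0.
HB.instance Definition _ := NormedZmod_PseudoMetric_eq.Build R realified erefl.
HB.instance Definition _ :=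
  PseudoMetricNormedZmod_Lmodule_isNormedModule.Build R realified normrZ.

Lemma realified_norm (x : realified) : `|x|%:C%C = `|x : V|.
Proof. exact: realified_normE. Qed.

Lemma realified_normB (x y : realified) (e : R) :
  (`|x - y| < e) = (`|(x : V) - (y : V)| < e%:C%C).
Proof. by rewrite -ltcR realified_norm. Qed.

End Realified.

Section RealifiedComplete.
Variables (R : realType) (V : completeNormedModType R[i]).

Let realified_complete (F : set_system (realified V)) :
  ProperFilter F -> cauchy F -> cvg F.
Proof.
move=> FF /cauchy_ballP Fc.
have FV : @cauchy V F.
  apply/cauchy_ballP => e e0.
  (* A positive element of [R[i]] is real, so both structures have the same balls. *)
  have er : e = (complex.Re e)%:C%C by rewrite RRe_real// gtr0_real.
  have Re0 : 0 < complex.Re e by rewrite -ltcR -er.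
  have [[P Q] /= FPQ PQ] := Fc _ Re0.
  exists (P, Q) => // -[x y] /= Pxy; have := PQ (x, y) Pxy.
  by rewrite /= -!ball_normE /ball_ /= realified_normB -er.
have FVF : @ProperFilter V F by [].
have /cvg_ex[l Fl] := @cauchy_cvg V F FVF FV.
apply/cvg_ex; exists l; apply/fcvgrPdist_lt => e e0.
have /fcvgrPdist_lt /(_ e%:C%C) := Fl; rewrite ltcR => /(_ e0).
by apply: filterS => x; rewrite realified_normB.
Qed.

HB.instance Definition _ := Uniform_isComplete.Build (realified V)
  realified_complete.

End RealifiedComplete.

(** * Extension of bounded functionals and separation of points *)

Section HahnBanachNormed.

(** The bound makes [g] constant on the fibres of [T], so the pairs [(T w, g w)] form a dominated
    graph and [g] extends from the range of [T]. *)
Lemma hahn_banach_real (R : realType) (V : normedModType R) (W : lmodType R)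
    (T : {linear W -> V}) (g : W -> R) (c : R) :
  linear (g : W -> R^o) -> 0 <= c -> (forall w, `|g w| <= c * `|T w|) ->
  exists f : V -> R, [/\ linear (f : V -> R^o), (forall x, `|f x| <= c * `|x|) &
    forall w, f (T w) = g w].
Proof.
move=> gL c0 gc; pose p (x : V) := c * `|x|.
have pD x y : p (x + y) <= p x + p y.
  by rewrite /p -mulrDr ler_wpM2l// ler_normD.
have pZ k x : 0 <= k -> p (k *: x) = k * p x.
  by move=> k0; rewrite /p normrZ ger0_norm// mulrCA.
pose G : set (V * R) := [set u | exists w, u = (T w, g w)].
have domG : dominated_graph p G.
  split.
  - by exists 0; rewrite linear0 (linear_fun0 gL).
  - by move=> k _ _ [u ->] [v ->]; exists (k *: u + v); rewrite linearP gL.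
  - by move=> _ [w ->] /=; exact: le_trans (ler_norm _) (gc w).
have [F [FL FG Fp]] := hahn_banach pD pZ domG.
exists F; split => //; last by move=> w; apply: (FG (T w, g w)); exists w.
have F0 : F 0 = 0 := linear_fun0 FL.
have FN x : F (- x) = - F x.
  by have := FL (-1) x 0; rewrite !addr0 scaleN1r F0 addr0 scaleN1r.
by move=> x; rewrite ler_norml Fp andbT lerNl -FN -[leRHS]/(p x) /p -normrN Fp.
Qed.

(** The real part of [g] extends to a real-linear [F], and [F x - i F (i x)] is the only
    complex-linear functional with real part [F]. *)
Lemma hahn_banach_complex (R : realType) (V : normedModType R[i])
    (W : lmodType R[i]) (T : {linear W -> V}) (g : W -> R[i]) (c : R[i]) :
  linear (g : W -> R[i]^o) -> 0 <= c -> (forall w, `|g w| <= c * `|T w|) ->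
  exists f : V -> R[i], [/\ linear (f : V -> R[i]^o),
    (forall x, `|f x| <= c * `|x|) & forall w, f (T w) = g w].
Proof.
move=> gL c0 gc.
have c_real : (complex.Re c)%:C%C = c by rewrite RRe_real// ger0_real.
have Rec0 : 0 <= complex.Re c by rewrite -lecR c_real.
pose p (x : realified V) := complex.Re c * `|x|.
have pD x y : p (x + y) <= p x + p y.
  by rewrite /p -mulrDr ler_wpM2l// ler_normD.
have pZ k x : 0 <= k -> p (k *: x) = k * p x.
  by move=> k0; rewrite /p normrZ ger0_norm// mulrCA.
pose G : set (realified V * R) :=
  [set u | exists w, u = (T w, complex.Re (g w))].
have g0 : g 0 = 0 := linear_fun0 gL.
have Re_mul (k : R) (z : R[i]) : complex.Re (k%:C%C * z) = k * complex.Re z.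
  by case: z => a b; simpc.
have domG : dominated_graph p G.
  split.
  - by exists 0; rewrite linear0 g0.
  - move=> k _ _ [u ->] [v ->]; exists (k%:C%C *: u + v).
    by rewrite linearP gL raddfD/= -[_ *: g u]/(_ * g u) Re_mul.
  - move=> _ [w ->] /=; rewrite -lecR rmorphM/= c_real realified_norm.
    apply: le_trans (gc w); apply: le_trans (normc_ge_Re _).
    by rewrite lecR ler_norm.
have [F [FL FG Fp]] := hahn_banach pD pZ domG.
have FD x y : F (x + y) = F x + F y by have := FL 1 x y; rewrite !scale1r.
have F0 : F 0 = 0 by apply/(addrI (F 0)); rewrite -FD !addr0.
have FZ (k : R) (x : V) : F (k%:C%C *: x) = k * F x.
  by have := FL k x 0; rewrite !addr0 F0 addr0.
pose f (x : V) : R[i] := (F x +i* (- F ('i%C *: x)))%C.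
have fL : linear (f : V -> R[i]^o).
  move=> [a b] x y.
  have E (z : V) : (a +i* b)%C *: z = a%:C%C *: z + b%:C%C *: ('i%C *: z).
    by rewrite scalerA -scalerDl; congr (_ *: _); simpc.
  rewrite /f scalerDr !FD E scalerDr !FD !scalerA.
  have -> : ('i * a%:C)%C *: x = a%:C%C *: ('i%C *: x) by rewrite scalerA mulrC.
  have -> : ('i * (b%:C * 'i))%C *: x = (- b)%:C%C *: x.
    by congr (_ *: _); simpc.
  rewrite -scalerA !FZ -[_ *: (_ +i* _)%C]/(_ * _); simpc.
  by congr (_ +i* _)%C; lra.
exists f; split => //.
- move=> x; have [->|fx0] := eqVneq (f x) 0; first by rewrite normr0 mulr_ge0.
  (* Rotating [x] by [u] of modulus one makes the value of [f] real, hence equal to that of [F],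
     which [p] dominates. *)
  pose u := `|f x| / f x.
  have u1 : `|u| = 1 by rewrite normrM normr_id normfV mulfV// normr_eq0.
  have fu : f (u *: x) = `|f x|.
    have := fL u x 0; rewrite !addr0 => ->.
    have -> : f 0 = 0 by rewrite /f scaler0 F0 oppr0.
    by rewrite addr0 -[_ *: f x]/(_ * _) /u mulfVK.
  rewrite -fu -[`|x|]mul1r -u1 -normrZ -[X in X <= _]RRe_real; last first.
    by rewrite fu normr_real.
  rewrite -realified_norm -c_real -rmorphM lecR; exact: Fp.
- move=> w; apply/eqP; rewrite eq_complex /=; apply/andP; split; apply/eqP.
    by apply: (FG (T w, complex.Re (g w))); exists w.
  (* The imaginary parts agree because [Re (i g w) = - Im (g w)]. *)
  rewrite -linearZ (FG (T ('i%C *: w), complex.Re (g ('i%C *: w)))); last first.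
    by exists ('i%C *: w).
  have := gL 'i%C w 0; rewrite !addr0 g0 addr0 => ->.
  by case: (g w) => a b; rewrite -[_ *: (_ +i* _)%C]/(_ * _); simpc.


Qed.

Theorem hahn_banach_along (K : numFieldType) (hK : real_or_complex K)
    (V : normedModType K) (W : lmodType K) (T : {linear W -> V})
    (g : W -> K) (c : K) :
  linear (g : W -> K^o) -> 0 <= c -> (forall w, `|g w| <= c * `|T w|) ->
  exists f : dual V, dual_bound f c /\ forall w, f (T w) = g w.
Proof.
move=> gL c0 gc.
suff [f [fL fc fT]] : exists f : V -> K, [/\ linear (f : V -> K^o),
    (forall x, `|f x| <= c * `|x|) & forall w, f (T w) = g w].
  by exists (Dual (bounded_dual_pred fL fc)).
case: hK => R [] E; subst K; [exact: hahn_banach_real|exact: hahn_banach_complex].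
Qed.

End HahnBanachNormed.

Section DualSeparates.
Variables (K : numFieldType) (hK : real_or_complex K) (V : normedModType K).

(** The functional sending [k *: x] to [k] times the norm of [x] is extended from the line through
    [x]; parametrizing the line by [k] covers [x = 0] too. *)
Lemma norming_functional (x : V) :
  exists f : dual V, dual_bound f 1 /\ f x = `|x|.
Proof.
pose T (k : K^o) : V := k *: x.
have TL : linear T by move=> k a b; rewrite /T scalerDl scalerA.
pose T' : {linear K^o -> V} := HB.pack T (GRing.isLinear.Build _ _ _ _ _ TL).
have [|w|f [f1 fT]] :=
  @hahn_banach_along _ hK V _ T' (fun k => k * `|x|) 1 _ ler01.
- by move=> k a b; rewrite mulrDl -mulrA.
- by rewrite mul1r normrM normr_id normrZ.
- by exists f; split => //; have := fT 1; rewrite /= /T scale1r mul1r.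
Qed.

Lemma dual_separates (x y : V) : (forall f : dual V, f x = f y) -> x = y.
Proof.
move=> xy; have [f [_ fx]] := norming_functional (x - y).
apply/eqP; rewrite -subr_eq0 -normr_eq0 -fx.
have -> : f (x - y) = f x - f y.
  by rewrite -scaleN1r addrC dual_linear scaleN1r addrC.
by rewrite xy subrr.
Qed.

End DualSeparates.

(** * The uniform boundedness principle over both fields *)

Section UniformBoundedness.

Lemma uniform_boundedness_real (R : realType) (V : completeNormedModType R)
    (W : normedModType R) (I : Type) (T : I -> V -> W) :
  (forall i, linear (T i)) ->
  (forall i, exists c, forall x, `|T i x| <= c * `|x|) ->
  (forall x, exists M, forall i, `|T i x| <= M) ->
  exists2 M, 0 <= M & forall i x, `|T i x| <= M * `|x|.
Proof.
move=> TL Tc TM.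
have [|x|M FM] := @Banach_Steinhauss _ V W (range T) _ _ 1.
- move=> _ [i _ <-]; split => // r; have [c ic] := Tc i.
  exists (`|c| * r) => x xr; apply: le_trans (ic x) _.
  apply: (@le_trans _ _ (`|c| * `|x|)); first by rewrite ler_wpM2r// ler_norm.
  by rewrite ler_wpM2l.
- by have [M xM] := TM x; exists M => _ [i _ <-].
exists `|M| => // i x; have [->|x0] := eqVneq x 0.
  by rewrite (linear_fun0 (TL i)) !normr0 mulr0.
have xp : 0 < `|x| by rewrite normr_gt0.
rewrite -ler_pdivrMr//; apply: (@le_trans _ _ M); last exact: ler_norm.
have := FM (T i) (imageT T i) (`|x|^-1 *: x).
rewrite normrZ normfV normr_id mulVf ?gt_eqF// => /(_ (lexx _)).
have -> : T i (`|x|^-1 *: x) = `|x|^-1 *: T i x.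
  have := TL i `|x|^-1 x 0; rewrite addr0 => ->.
  by rewrite (linear_fun0 (TL i)) addr0.
by rewrite normrZ normfV normr_id mulrC.
Qed.

Theorem uniform_boundedness (K : numFieldType) (hK : real_or_complex K)
    (V : completeNormedModType K) (W : normedModType K) (I : Type)
    (T : I -> V -> W) :
  (forall i, linear (T i)) ->
  (forall i, exists c, forall x, `|T i x| <= c * `|x|) ->
  (forall x, exists M, forall i, `|T i x| <= M) ->
  exists2 M, 0 <= M & forall i x, `|T i x| <= M * `|x|.
Proof.
case: hK => R [] E; subst K; first exact: uniform_boundedness_real.
have leC (x : W) (M : R[i]) : `|x| <= M -> `|x : realified W| <= complex.Re M.
  move=> xM; have M0 : 0 <= M by exact: le_trans xM.
  by rewrite -lecR realified_norm RRe_real// ger0_real.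
move=> TL Tc TM.
have [i k x y|i|x|M M0 iM] :=
  @uniform_boundedness_real R (realified V) (realified W) I T.
- exact: TL.
(* A nonzero vector forces [c] to be nonnegative, hence real; at zero both sides vanish. *)
- have [c ic] := Tc i; exists `|complex.Re c| => x.
  have [->|x0] := eqVneq (x : V) 0.
    have T0 : T i 0 = 0 := linear_fun0 (TL i).
    by rewrite [T i _]T0 !normr0 mulr0.
  have xp : 0 < `|x : V| by rewrite normr_gt0.
  have c0 : 0 <= c by rewrite -(pmulr_lge0 _ xp); exact: le_trans (ic x).
  have cE : (complex.Re c)%:C%C = c by rewrite RRe_real// ger0_real.
  have Rc0 : 0 <= complex.Re c by rewrite -lecR cE.
  by rewrite (ger0_norm Rc0) -lecR rmorphM/= !realified_norm cE; exact: ic.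
- by have [M xM] := TM x; exists (complex.Re M) => i; exact: leC.
exists M%:C%C; first by rewrite lecR.
by move=> i x; rewrite -!realified_norm -rmorphM lecR.
Qed.

End UniformBoundedness.

(** * Limits along ultrafilters and weak* compactness *)

(** Compactness of a closed segment settles the real case; complex values are treated through their
    real and imaginary parts. *)
Lemma bounded_ultra_cvg (K : numFieldType) (hK : real_or_complex K) (D : Type)
    (U : set_system D) (UU : UltraFilter U) (x : D -> K^o) (M : K) :
  (forall d, `|x d| <= M) -> exists l : K^o, x d @[d --> U] --> l.
Proof.
have real (R : realType) (y : D -> R^o) (N : R) :
    (forall d, `|y d| <= N) -> exists l : R^o, y d @[d --> U] --> l.
  move=> yN; have [|l [_ yl]] := @segment_compact R (- N) N (y @ U) _.
    by apply: (@filterE _ U) => d; rewrite /= in_itv/= -ler_norml; exact: yN.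
  exists l => B lB; have [//|nB] := in_ultra_setVsetC (y @^-1` B) UU.
  by have [z []] := yl (~` B) B nB lB.
case: hK => R [] E; subst K; first exact: real.
move=> xM; pose N := complex.Re M.
have xN d : complex.Re `|x d| <= N by have := xM d; rewrite lecE => /andP[].
have nE (z : R[i]) : (complex.Re `|z|)%:C%C = `|z| by exact/RRe_real/normr_real.
have [d|a xa] := real R (fun d => complex.Re (x d)) N.
  by apply: le_trans (xN d); rewrite -lecR nE normc_ge_Re.
have normi : `|'i%C| = 1 :> R[i].
  by rewrite normc_def/= expr0n expr1n add0r sqrtr1.
have Im_Re (z : R[i]) : complex.Im z = complex.Re (- 'i%C * z).
  by case: z => u v; simpc.
have [d|b xb] := real R (fun d => complex.Im (x d)) N.
  apply: le_trans (xN d); rewrite -lecR nE Im_Re.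
  apply: le_trans (normc_ge_Re _) _.
  by rewrite normrM normrN normi mul1r.
exists (a +i* b)%C; apply/cvgrPdist_lt => e e0.
have eE : (complex.Re e)%:C%C = e by rewrite RRe_real// gtr0_real.
have Re0 : 0 < complex.Re e by rewrite -ltcR eE.
have e20 : 0 < complex.Re e / 2 by rewrite divr_gt0.
move/cvgrPdist_lt : xa => /(_ _ e20) xa; move/cvgrPdist_lt : xb => /(_ _ e20) xb.
apply: filterS2 xa xb => d /= ad bd.
have -> : (a +i* b)%C - x d =
    (a - complex.Re (x d))%:C%C + 'i%C * (b - complex.Im (x d))%:C%C.
  by case: (x d) => u v /=; simpc.
apply: le_lt_trans (ler_normD _ _) _.
rewrite normrM normi mul1r -eE (splitr (complex.Re e)) [ltRHS]rmorphD ltrD//.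
  by rewrite normc_def/= expr0n addr0 sqrtr_sqr ltcR.
by rewrite normc_def/= expr0n addr0 sqrtr_sqr ltcR.
Qed.

(** If the preimage of a neighbourhood were not in [F], some ultrafilter above [F] would contain its
    complement. *)
Lemma ultra_cvg (T : topologicalType) (D : Type) (F : set_system D)
    {FF : ProperFilter F} (x : D -> T) (l : T) :
  (forall U, UltraFilter U -> F `<=` U -> x d @[d --> U] --> l) ->
  x d @[d --> F] --> l.
Proof.
move=> xl A lA; apply: contrapT => nFA.
pose B := ~` (x @^-1` A).
pose G : set_system D := filter_from F (fun S => S `&` B).
have GF : ProperFilter G.
  apply: filter_from_proper; first last.
    move=> S FS; apply/set0P/eqP => SB; apply: nFA.
    apply: (@filterS _ F _ S) FS => d Sd.
    by apply: contrapT => nAd; have : (S `&` B) d by []; rewrite SB.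
  apply: filter_from_filter; first by exists setT; exact: filterT.
  move=> S S' FS FS'; exists (S `&` S'); first exact: filterI.
  by move=> d [[]].
have [U [UU GU]] := ultraFilterLemma GF.
have UA : U (x @^-1` A).
  apply: (xl U UU _ A lA) => S FS; apply: GU; exists S => //; exact: subIsetl.
have UB : U B by apply: GU; exists setT; [exact: filterT|move=> d []].
have [d [Ad Bd]] := @filter_ex _ U _ _ (filterI UA UB).
exact: Bd.
Qed.

Lemma cvg_norm_le (K : numFieldType) (V : normedModType K) (D : Type)
    (F : set_system D) {FF : ProperFilter F} (x : D -> V) (l : V) (M : K) :
  x d @[d --> F] --> l -> (forall d, `|x d| <= M) -> `|l| <= M.
Proof.
move=> xl xM; have [d0 _] := @filter_ex _ F _ setT filterT.
(* The order of [K] may be partial; [M] is real because it bounds a norm. *)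
have Mr : M \is Num.real by apply: ger0_real; exact: le_trans (xM d0).
rewrite real_leNgt ?normr_real//; apply/negP => Ml.
have e0 : 0 < `|l| - M by rewrite subr_gt0.
move/cvgrPdist_lt : xl => /(_ _ e0) xl.
have [d ld] := @filter_ex _ F _ _ xl.
have := ler_ltD (xM d) ld.
rewrite [ltRHS]addrC subrK => lt; suff: `|l| < `|l| by rewrite ltxx.
have := ler_normD (x d) (l - x d); rewrite (addrC (x d)) subrK.
by move=> /le_lt_trans; apply.
Qed.

Lemma initial_topology_cvg (S : choiceType) (T : topologicalType) (f : S -> T)
    (F : set_system S) {FF : Filter F} (s : S) :
  F --> (s : initial_topology f) <-> f @ F --> f s.
Proof.
split=> [Fs|Fs].
  by move=> A /(@initial_continuous S T f s) /Fs.
move=> A; rewrite nbhsE => -[B [[O oO <-] Os] BA].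
have /Fs : nbhs (f s) O by apply: open_nbhs_nbhs.
by apply: (@filterS _ F) => x Ox; exact: BA.
Qed.

Section BidualLimits.
Variables (K : numFieldType) (hK : real_or_complex K) (V : normedModType K).

Lemma bidual_cvgP (D : Type) (F : set_system D) {FF : Filter F}
    (N : D -> bidual V) (n : bidual V) :
  N d @[d --> F] --> n <-> forall f, N d f @[d --> F] --> n f.
Proof.
rewrite (@initial_topology_cvg (bidual V) {ptws dual V -> K^o}) cvg_sup.
split=> Nn f; have := Nn f; rewrite initial_topology_cvg; exact.
Qed.

(** Banach-Alaoglu for bounded nets of [V]: the functional is the pointwise limit on the dual, and
    linearity and the bound [M] pass to the limit. *)
Lemma ultra_bidual_limit (D : Type) (U : set_system D) (UU : UltraFilter U)
    (e : D -> V) (M : K) : (forall d, `|e d| <= M) ->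
  exists n : bidual V, forall f : dual V, f (e d) @[d --> U] --> n f.
Proof.
move=> eM.
have ex (f : dual V) : exists l : K^o, f (e d) @[d --> U] --> l.
  have [c [c0 fc]] := dual_boundW f.
  apply: (@bounded_ultra_cvg K hK D U UU (fun d => f (e d)) (c * M)) => d.
  by apply: le_trans (fc _) _; rewrite ler_wpM2l.
have [n nP] := choice ex.
suff nb : n \in @bidual_pred K V by exists (Bidual nb).
apply/asboolP; split.
  move=> k f g; apply: (@cvg_unique K^o) (nP _) _ => //.
  have -> : (fun d => (k *: f + g : dual V) (e d)) =
      (fun d => (k * f (e d)) + g (e d)) by [].
  apply: (@cvgD K K^o); last exact: nP.
  by apply: (@cvgMl_tmp _ _ _ _ (fun d => f (e d))); exact: nP.
exists M => f c [c0 fc].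
apply: (@cvg_norm_le K K^o D U _ (fun d => f (e d)) (n f) (M * c)).
  exact: nP.
by move=> d; apply: le_trans (fc _) _; rewrite mulrC ler_wpM2r.
Qed.

End BidualLimits.

(** * Left and right notions under one parameter *)

(* Part (ii) is part (i) for the opposite product. Both are proved at once:
   [smul true] is the product, [smul false] the opposite one, and likewise
   [true] stands for the left-hand notions (LM, Z_t^(l), ...). *)
Section SidedProduct.
Variables (K : numFieldType) (s : bool).
Implicit Types A : banachAlgType K.

Definition smul A (a b : A) : A := if s then a ** b else b ** a.

Definition is_smultiplier A (T : blin A A) : Prop := if s then LM T else RM T.

Definition is_smult A (T : A -> A) : Prop := exists a, forall x, T x = smul a x.

Definition restr_is_smult A (T : A -> A) (C : closed_subalg A) : Prop :=
  exists c, carrier C c /\ forall x, carrier C x -> T x = smul c x.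

Definition scenter A : set (bidual A) := if s then Zl A else Zr A.

Lemma smulA A (a b c : A) : smul a (smul b c) = smul (smul a b) c.
Proof. by rewrite /smul; case: s; rewrite bmulA. Qed.

Lemma smul_linearl A (b : A) : linear (fun a => smul a b).
Proof.
by rewrite /smul; case: s => k x y; [exact: bmul_linearl|exact: bmul_linearr].
Qed.

Lemma smul_norm A (a b : A) : `|smul a b| <= `|a| * `|b|.
Proof. by rewrite /smul; case: s; rewrite ?bmul_norm// mulrC bmul_norm. Qed.

Lemma csa_smulE A (B : closed_subalg A) (x y : csa B) :
  csa_val (smul x y) = smul (csa_val x) (csa_val y).
Proof. by rewrite /smul; case: s. Qed.

Lemma is_smultiplierP A (T : blin A A) :
  is_smultiplier T <-> forall a b, T (smul a b) = smul (T a) b.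
Proof.
by rewrite /is_smultiplier /smul; case: s; split=> H a b; exact: H.
Qed.

Definition sact A (f : dual A) (a : A) : dual A :=
  if s then actr f a else actl a f.

Lemma sactE A (f : dual A) (a b : A) : sact f a b = f (smul a b).
Proof. by rewrite /sact /smul; case: s. Qed.

Definition sbact A (n : bidual A) (f : dual A) : dual A :=
  if s then bactl n f else bactr f n.

Lemma sbactE A (n : bidual A) (f : dual A) a : sbact n f a = n (sact f a).
Proof. by rewrite /sbact /sact; case: s. Qed.

Definition sfactored A : set (dual A) := if s then dualA A else Adual A.

Lemma sfactoredP A (f : dual A) : sfactored f <-> exists g a, f = sact g a.
Proof.
rewrite /sfactored /sact; case: s; first by [].
by split=> -[x [y ->]]; exists y, x.
Qed.

End SidedProduct.

(** With this, the opposite action [sact (~~ s) f a] evaluated at [b] becomes [f (smul s b a)]. *)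
Lemma smulN (K : numFieldType) (A : banachAlgType K) s (a b : A) :
  smul (~~ s) a b = smul s b a.
Proof. by rewrite /smul; case: s. Qed.

(** * Bounded linear maps and the topological centre along bounded nets *)

Section Continuity.
Variables (K : numFieldType).

Lemma bounded_linear_cvg (V W : normedModType K) (T : V -> W) c :
  linear T -> (forall x, `|T x| <= c * `|x|) ->
  forall (D : Type) (F : set_system D), Filter F ->
  forall (x : D -> V) (l : V),
  x d @[d --> F] --> l -> T (x d) @[d --> F] --> T l.
Proof.
move=> TL Tc D F FF x l xl; apply/cvgrPdist_lt => e e0.
(* On the zero space [c] could be negative; otherwise a nonzero vector forces [0 <= c]. *)
have [d0|d0] := pselect (exists v : V, v != 0); last first.
  apply: filterE => d.
  have E (v w : V) : v = w.
    apply/eqP; rewrite -subr_eq0; apply/negPn/negP => vw.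
    by apply: d0; exists (v - w).
  by rewrite (E (x d) l) subrr normr0.
have c0 : 0 <= c.
  have [v v0] := d0; have vp : 0 < `|v| by rewrite normr_gt0.
  by rewrite -(pmulr_lge0 _ vp); exact: le_trans (Tc v).
have c1 : 0 < c + 1 by rewrite ltr_wpDl.
move/cvgrPdist_lt : xl => /(_ (e / (c + 1))); rewrite divr_gt0// => /(_ isT).
apply: filterS => d; rewrite ltr_pdivlMr// => ld.
have -> : T l - T (x d) = T (l - x d).
  by rewrite addrC -scaleN1r -TL scaleN1r addrC.
apply: le_lt_trans (Tc _) _; apply: le_lt_trans ld.
by rewrite mulrC ler_wpM2l// lerDl.
Qed.

Lemma dual_cvg (V : normedModType K) (f : dual V) (D : Type)
    (F : set_system D) {FF : Filter F} (x : D -> V) (l : V) :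
  x d @[d --> F] --> l -> f (x d) @[d --> F] --> f l.
Proof.
have [c [c0 fc]] := dual_boundW f.
by move=> xl; apply: (@bounded_linear_cvg V K^o f c (@dual_linear _ _ f) fc).
Qed.

End Continuity.

Section WeakStarContinuity.
Variables (K : numFieldType) (hK : real_or_complex K).
Variables (A : banachAlgType K) (s : bool).

Variables (D : Type) (F : set_system D) (FF : ProperFilter F).
Variables (e : D -> A) (M : K) (eM : forall d, `|e d| <= M).

(* Along an ultrafilter the bounded net e has a weak* limit n, and n.f = phi
   does not depend on the ultrafilter; continuity then gives m(n.f) = m(phi) as
   the limit of m(e_d.f). *)
Lemma scenter_cvg (m : bidual A) (f phi : dual A) : scenter s m ->
  (forall a, f (smul s a (e d)) @[d --> F] --> phi a) ->
  m (sact (~~ s) f (e d)) @[d --> F] --> m phi.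
Proof.
move=> Zm fphi; apply: ultra_cvg => U UU FU.
have [n en] := ultra_bidual_limit hK UU eM.
have nphi : sbact s n f = phi.
  apply: dualP => a; rewrite sbactE; apply: (@cvg_unique K^o) (en _) _ => //.
  move=> S /fphi FS; apply: FU; move: FS; rewrite /nbhs/=; congr F.
  by apply/funext => d; rewrite /= sactE.
have {}en : to_bidual (e d) @[d --> U] --> n by apply/bidual_cvgP.
move: Zm nphi; rewrite /scenter /sbact /sact; case: s => Zm <-.
(* Evaluated at [f], the product [m □ to_bidual (e d)] is [m (actl (e d) f)]. *)
- have /bidual_cvgP /(_ f) : (m □ to_bidual (e d)) @[d --> U] --> m □ n.
    have mn : {for n, continuous (fun n => m □ n)} := Zm n.
    exact: (cvg_comp _ _ en mn).
  apply: cvg_trans; apply: near_eq_cvg; apply: filterE => d /=.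
  by congr (m _); exact: dualP.
- have /bidual_cvgP /(_ f) : (to_bidual (e d) △ m) @[d --> U] --> n △ m.
    have mn : {for n, continuous (fun n => n △ m)} := Zm n.
    exact: (cvg_comp _ _ en mn).
  apply: cvg_trans; apply: near_eq_cvg; apply: filterE => d /=.
  by congr (m _); exact: dualP.
Qed.

(** Any ultrafilter above [F] gives a weak* limit [n] of the net, and [n.f] is the pointwise limit
    along [F], so it can serve as [phi] in [scenter_cvg]. *)
Lemma scenter_is_cvg (m : bidual A) (f : dual A) : scenter s m ->
  (forall a, exists l : K^o, f (smul s a (e d)) @[d --> F] --> l) ->
  exists l : K^o, m (sact (~~ s) f (e d)) @[d --> F] --> l.
Proof.
move=> Zm fe; have [U [UU FU]] := ultraFilterLemma FF.
have [n en] := ultra_bidual_limit hK UU eM.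
exists (m (sbact s n f)); apply: scenter_cvg => // a.
have [l fl] := fe a; rewrite sbactE.
suff -> : n (sact s f a) = l by [].
apply: (@cvg_unique K^o) (en _) _ => //.
move=> S /fl FS; apply: FU; move: FS; rewrite /nbhs/=; congr F.
by apply/funext => d; rewrite /= sactE.
Qed.

End WeakStarContinuity.

(** * Multipliers attached to elements of the bidual *)

Section Action.
Variables (K : numFieldType) (A : banachAlgType K) (s : bool).

Lemma dual_bound_sact (f : dual A) c a : dual_bound f c ->
  dual_bound (sact s f a) (c * `|a|).
Proof.
move=> [c0 fc]; split; first by rewrite mulr_ge0.
move=> b; rewrite sactE -mulrA; apply: le_trans (fc _) _.
by rewrite ler_wpM2l// smul_norm.
Qed.

Lemma sact_linear (f : dual A) k a b :
  sact s f (k *: a + b) = k *: sact s f a + sact s f b.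
Proof.
by apply: dualP => x; rewrite dual_linE !sactE smul_linearl dual_linear.
Qed.

End Action.

Lemma BAI_net (K : numFieldType) (A : banachAlgType K) (s : bool) : has_BAI A ->
  exists (D : Type) (F : set_system D) (e : D -> A) (M : K),
    [/\ ProperFilter F, (forall d, `|e d| <= M),
        (forall a, smul s (e d) a @[d --> F] --> a) &
        (forall a, smul s a (e d) @[d --> F] --> a)].
Proof.
move=> [D [le [e [[[d0] lexx letr leub] [M eM] el er]]]].
exists D, (tails le), e, M; split => //.
- apply: filter_from_proper; last by move=> d _; exists d; exact: lexx.
  apply: filter_from_filter; first by exists d0.
  move=> d1 d2 _ _; have [d3 [d13 d23]] := leub d1 d2.
  by exists d3 => // d d3d; split; [exact: letr d13 d3d|exact: letr d23 d3d].
- by rewrite /smul; case: s => a; [exact: el|exact: er].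
- by rewrite /smul; case: s => a; [exact: er|exact: el].
Qed.

Section LeftAction.
Variables (K : numFieldType) (hK : real_or_complex K).
Variables (A : banachAlgType K) (s : bool).
Implicit Types (m : bidual A).

(** This is m.A inside A (A.m inside A when [s] is false), tested on functionals: the product of [m]
    and [a] sends [f] to [m (sact (~~ s) f a)]. *)
Definition keeps_algebra m : Prop :=
  forall a, exists b, forall f, m (sact (~~ s) f a) = f b.

(** Functionals separate points, so linearity and the multiplier law of [mu] are checked under every
    [f]; a norming functional of [mu a] bounds [mu]. *)
Lemma multiplier_of m : keeps_algebra m ->
  exists mu : blin A A, is_smultiplier s mu /\
    forall f a, m (sact (~~ s) f a) = f (mu a).
Proof.
move=> /choice[mu muP].
have muL : linear mu.
  move=> k a b; apply: (dual_separates hK) => f.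
  by rewrite -muP sact_linear bidual_linear !muP dual_linear.
have [C C0 mC] := bidual_boundedW m.
have muC a : `|mu a| <= C * `|a|.
  have [f [f1 fa]] := norming_functional hK (mu a).
  rewrite -[`|mu a|]normr_id -fa -muP.
  by have := mC _ _ (dual_bound_sact (~~ s) a f1); rewrite mul1r.
pose mu' : {linear A -> A} := HB.pack mu (GRing.isLinear.Build _ _ _ _ _ muL).
have muc : continuous mu' by move=> x; exact: (bounded_linear_cvg muL muC).
exists (Blin muc); split => [|f a]; last exact: muP.
apply/is_smultiplierP => a b; apply: (dual_separates hK) => f /=.
rewrite -[LHS]/(f (mu _)) -[RHS]/(f (smul s (mu a) b)).
(* For [s = true] this is the identity [(ab).f = a.(b.f)]. *)
rewrite -muP -(smulN s b (mu a)) -sactE -muP; congr (m _); apply: dualP => x.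
by rewrite !sactE !smulN smulA.
Qed.

(** Along a bounded approximate identity [f (a e_d)] tends to [f a], so by [scenter_cvg] the values
    [m (e_d.f) = f (c e_d)] tend to [m f]; they also tend to [f c]. *)
Lemma scenter_mult m c : scenter s m -> has_BAI A ->
  (forall f a, m (sact (~~ s) f a) = f (smul s c a)) -> m = to_bidual c.
Proof.
move=> Zm bai mc; apply: bidualP => f.
have [D [F [e [M [FF eM el er]]]]] := BAI_net s bai.
have mf : m (sact (~~ s) f (e d)) @[d --> F] --> m f.
  by apply: (scenter_cvg hK FF eM Zm) => a; apply: dual_cvg; exact: er.
apply: (@cvg_unique K^o) mf _ => //.
have -> : (fun d => m (sact (~~ s) f (e d))) = (fun d => f (smul s c (e d))).
  by apply/funext => d; exact: mc.
by apply: dual_cvg; exact: er.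
Qed.

End LeftAction.

(** * Sided forms of the types, and projections onto one-sided ideals *)

Section SidedTypes.
Variables (K : numFieldType) (s : bool).
Implicit Types A B : banachAlgType K.

(** For a literal [s] this is [condition_L] or [condition_R] by conversion; likewise for
    [sided_type]. *)
Definition sided_condition B : Prop :=
  has_BAI B /\
  exists (I : Type) (J : I -> closed_subalg B),
    [/\ (forall i x y, carrier (J i) y -> carrier (J i) (smul s x y)),
        (forall i, WSC (csa (J i)) /\ has_seq_AI (csa (J i))),
        (forall i, exists p : {linear B -> csa (J i)},
           (forall y, p (csa_val y) = y) /\
           (forall x y, p (smul s x (csa_val y)) = smul s (p x) y)) &
        (forall nu : blin B B, is_smultiplier s nu ->
           (forall i, restr_is_smult s nu (J i)) -> is_smult s nu)].

Definition sided_type A : Prop :=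
  has_BAI A /\
  forall mu : blin A A, is_smultiplier s mu -> exists B : closed_subalg A,
    [/\ sided_condition (csa B),
        (forall f, sfactored s f -> sfactored s (adjoint (csa_incl B) f)),
        (forall x, carrier B x -> carrier B (mu x)) &
        (restr_is_smult s mu B -> is_smult s mu)].

End SidedTypes.

Section IdealProjection.
Variables (K : numFieldType) (hK : real_or_complex K) (s : bool).
Variables (B : banachAlgType K) (J : closed_subalg B).
Hypothesis Jideal : forall x y, carrier J y -> carrier J (smul s x y).
Variable p : {linear B -> csa J}.
Hypothesis pK : forall y, p (csa_val y) = y.
Hypothesis pM : forall x y, p (smul s x (csa_val y)) = smul s (p x) y.

Lemma carrier_csa (x : B) : carrier J x -> exists y : csa J, csa_val y = x.
Proof.
move=> Jx; have xP : x \in csa_pred J by rewrite !inE.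
by exists (Csa xP).
Qed.

Lemma csa_val_carrier (y : csa J) : carrier J (csa_val y).
Proof. by apply: set_mem; exact: csa_valP. Qed.

(** The product of [x] and [y] lies in the ideal, so [p] fixes it, while [pM] takes [y] out of
    [p]. *)
Lemma ideal_projection_smul x (y : csa J) :
  csa_val (smul s (p x) y) = smul s x (csa_val y).
Proof.
have [z zE] := carrier_csa (Jideal x (csa_val_carrier y)).
by rewrite -pM -zE pK.
Qed.

Lemma is_seq_AI_smul (C : banachAlgType K) (e : nat -> C) : is_seq_AI e ->
  forall a, smul s (e n) a @[n --> \oo] --> a /\
            smul s a (e n) @[n --> \oo] --> a.
Proof.
by move=> [el er] a; rewrite /smul; case: s; split; exact: el || exact: er.
Qed.

Variable e : nat -> csa J.
Hypothesis eAI : is_seq_AI e.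

Lemma ideal_projection_cvg x :
  smul s x (csa_val (e n)) @[n --> \oo] --> csa_val (p x).
Proof.
have [_ pe] := is_seq_AI_smul eAI (p x).
have -> : (fun n => smul s x (csa_val (e n))) =
    @csa_val _ _ J \o (fun n => smul s (p x) (e n)).
  by apply/funext => n /=; rewrite ideal_projection_smul.
apply: (cvg_comp _ _ pe); exact: csa_val_continuous.
Qed.

(** The products [x e_n] converge for every [x], hence are uniformly bounded, and their limit [p x]
    inherits the bound. Taking for [x] the bounded approximate identity [b] of [B] bounds each
    [e n], the limit of [b_d e_n]. *)
Lemma ideal_projection_bounded : has_BAI B ->
  (exists M, forall n, `|e n| <= M) /\ exists M, forall x, `|p x| <= M * `|x|.
Proof.
move=> bai.
have [n|n|x|M M0 eM] :=
  @uniform_boundedness K hK B B nat (fun n x => smul s x (csa_val (e n))).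
- exact: smul_linearl.
- by exists `|csa_val (e n)| => x; rewrite mulrC smul_norm.
- have xe : cvg (smul s x (csa_val (e n)) @[n --> \oo]).
    by apply/cvg_ex; eexists; exact: ideal_projection_cvg.
  have /pinfty_ex_gt0[M M0 xM] := cvg_seq_bounded xe.
  by exists M => n; exact: xM.
split; last first.
  exists M => x; rewrite csa_normE.
  exact: (cvg_norm_le (@ideal_projection_cvg x) (eM ^~ x)).
have [D [F [b [M' [FF bM bl _]]]]] := BAI_net s bai.
exists (M * M') => n; rewrite csa_normE.
apply: (cvg_norm_le (bl (csa_val (e n)))) => d.
by apply: le_trans (eM n (b d)) _; rewrite ler_wpM2l.
Qed.

End IdealProjection.

Lemma blin_bound (K : numFieldType) (V W : normedModType K) (T : blin V W) :
  exists c, forall x, `|T x| <= c * `|x|.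
Proof.
have /linear_boundedP /pinfty_ex_gt0 [c _ Tc] : bounded_near T (nbhs 0).
  by apply/linear_bounded_continuous; exact: blin_continuous.
by exists c.
Qed.

Lemma weakly_complete_limit (K : numFieldType) (V : normedModType K)
    (x : nat -> V) : WSC V ->
  (forall f : dual V, exists l : K^o, f (x n) @[n --> \oo] --> l) ->
  exists c : V, forall f : dual V, f (x n) @[n --> \oo] --> f c.
Proof.
move=> wsc xl; apply: wsc => f; have [l fl] := xl f.
by apply: cvg_cauchy; apply/cvg_ex; exists l.
Qed.

(** * From multiplication on the ideals to membership of the functional in the algebra *)

Section Main.
Variables (K : numFieldType) (hK : real_or_complex K) (s : bool).
Variables (A : banachAlgType K) (m : bidual A).
Hypothesis Zm : scenter s m.
Variable mu : blin A A.
Hypothesis muM : is_smultiplier s mu.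
Hypothesis muP : forall f a, m (sact (~~ s) f a) = f (mu a).

Section Ideal.
Variables (B : closed_subalg A) (J : closed_subalg (csa B)).
Hypothesis Bbai : has_BAI (csa B).
Hypothesis Bfactored :
  forall f, sfactored s f -> sfactored s (adjoint (csa_incl B) f).
Hypothesis Jideal : forall x y, carrier J y -> carrier J (smul s x y).
Hypothesis JW : WSC (csa J).
Variable p : {linear csa B -> csa J}.
Hypothesis pK : forall y, p (csa_val y) = y.
Hypothesis pM : forall x y, p (smul s x (csa_val y)) = smul s (p x) y.
Variable e : nat -> csa J.
Hypothesis eAI : is_seq_AI e.
Variable nu : blin (csa B) (csa B).
Hypothesis nuM : is_smultiplier s nu.
Hypothesis nuE : forall x, csa_val (nu x) = mu (csa_val x).

Lemma restr_cvg (g : dual (csa J)) :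
  exists l : K^o, g (p (nu (csa_val (e n)))) @[n --> \oo] --> l.
Proof.
have [[E eE] [M pb]] := ideal_projection_bounded hK Jideal pK pM eAI Bbai.
have pcvg := @ideal_projection_cvg _ _ _ _ Jideal p pK pM _ eAI.
have [c [c0 gc]] := dual_boundW g.
have gpL : linear (g \o p : csa B -> K^o).
  by move=> k x y /=; rewrite linearP dual_linear.
(* Hahn-Banach extends [g \o p] from [B] to [A]. The absolute value of [M] covers the zero space,
   where [M] may be negative. *)
have [f [_ fT]] : exists f : dual A, dual_bound f (c * `|M|) /\
    forall x : csa B, f (csa_val x) = g (p x).
  apply: (hahn_banach_along hK (T := @csa_val _ _ B) gpL) => [|x].
    by rewrite mulr_ge0.
  rewrite -mulrA; apply: le_trans (gc _) _; rewrite ler_wpM2l//.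
  apply: le_trans (pb x) _.
  have [->|x0] := eqVneq x 0; first by rewrite !normr0 !mulr0.
  have xp : 0 < `|x| by rewrite normr_gt0.
  have M0 : 0 <= M by rewrite -(pmulr_lge0 _ xp); exact: le_trans (pb x).
  by rewrite (ger0_norm M0).
pose u n : A := csa_val (csa_val (e n)).
have uE n : `|u n| <= E by exact: eE.
have [|l ul] := scenter_is_cvg hK _ uE Zm (F := \oo) (f := f).
  (* On [B] the functional [f.a] is some [k.b], so [f (a e_n) = k (b e_n)] tends to [k (p b)]. *)
  move=> a; have /Bfactored/sfactoredP[k [b fa]] : sfactored s (sact s f a).
    by apply/sfactoredP; exists f, a.
  exists (k (csa_val (p b))).
  have -> : (fun n => f (smul s a (u n))) =
      (fun n => k (smul s b (csa_val (e n)))).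
    by apply/funext => n; rewrite -!sactE -fa.
  by apply: dual_cvg; exact: pcvg.
exists l; apply: cvg_trans ul; apply: near_eq_cvg; apply: filterE => n.
by rewrite muP -nuE fT.
Qed.

(** The multiplying element [c] is the weak limit of [p (nu e_n)]. The sequence
    [nu (e_n y) = nu (e_n) y] tends to [nu y] in norm and to [c y] weakly. *)
Lemma restr_ideal : restr_is_smult s nu J.
Proof.
have [[E eE] [M pb]] := ideal_projection_bounded hK Jideal pK pM eAI Bbai.
have [c cP] := weakly_complete_limit JW restr_cvg.
have /is_smultiplierP nuM' := nuM.
exists (csa_val c); split; first exact: csa_val_carrier.
move=> x /carrier_csa[y <-].
pose w n := nu (csa_val (smul s (e n) y)).
have wE n : w n = smul s (nu (csa_val (e n))) (csa_val y).
  by rewrite /w csa_smulE nuM'.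
have wy : w n @[n --> \oo] --> nu (csa_val y).
  have [ey _] := is_seq_AI_smul s eAI y.
  have vy : csa_val (smul s (e n) y) @[n --> \oo] --> csa_val y.
    exact: (cvg_comp _ _ ey (@csa_val_continuous _ _ J y)).
  exact: (cvg_comp _ _ vy (@blin_continuous _ _ _ nu (csa_val y))).
have pL : linear p by move=> k a b; rewrite linearP.
have pwy : p (w n) @[n --> \oo] --> p (nu (csa_val y)).
  exact: (bounded_linear_cvg pL pb).
(* Each [w n] lies in the ideal, hence so does the limit [nu y]. *)
have wp n : csa_val (p (w n)) = w n.
  have [z zE] := carrier_csa (Jideal (nu (csa_val (e n))) (csa_val_carrier y)).
  by rewrite wE -zE pK.
have -> : nu (csa_val y) = csa_val (p (nu (csa_val y))).
  apply: (@cvg_unique (csa B)) wy _ => //.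
  have -> : w = (fun n => csa_val (p (w n))) by apply/funext => n; rewrite wp.
  exact: (cvg_comp _ _ pwy (@csa_val_continuous _ _ J _)).
rewrite -csa_smulE; congr csa_val; apply: (dual_separates hK) => g.
have gw : g (p (w n)) @[n --> \oo] --> g (p (nu (csa_val y))) by exact: dual_cvg.
apply: (@cvg_unique K^o) gw _ => //.
(* Weak convergence is applied to the functional taking [z] to [g (smul s z y)]. *)
have := cP (sact (~~ s) g y); rewrite sactE smulN.
apply: cvg_trans; apply: near_eq_cvg; apply: filterE => n.
by rewrite sactE smulN wE pM.
Qed.

End Ideal.

(** [mu] restricts to a multiplier of [B] that is a multiplication on each ideal of the family, and
    the last clause of the condition makes it a multiplication on [B]. *)
Lemma restr_subalgebra (B : closed_subalg A) : sided_condition s (csa B) ->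
  (forall f, sfactored s f -> sfactored s (adjoint (csa_incl B) f)) ->
  (forall x, carrier B x -> carrier B (mu x)) ->
  restr_is_smult s mu B.
Proof.
move=> [Bbai [I [J [Jideal JW Jp Jnu]]]] Bfact muB.
have nu_ex (x : csa B) : exists y : csa B, csa_val y = mu (csa_val x).
  by apply: carrier_csa; apply: muB; exact: csa_val_carrier.
have [nu nuE] := choice nu_ex.
have nuL : linear nu.
  move=> k x y; apply: val_inj => /=.
  by rewrite [LHS]nuE !linearP/= -!nuE.
have [c muc] := blin_bound mu.
have nuc x : `|nu x| <= c * `|x| by rewrite csa_normE nuE; exact: muc.
pose nu1 : {linear csa B -> csa B} :=
  HB.pack nu (GRing.isLinear.Build _ _ _ _ _ nuL).
have nu1c : continuous nu1.
  by move=> x; exact: (@bounded_linear_cvg _ _ _ _ _ nuL nuc _ (nbhs x) _ id x).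
pose nu' := Blin nu1c.
have nu'E x : csa_val (nu' x) = mu (csa_val x) by exact: nuE.
have nuM : is_smultiplier s nu'.
  apply/is_smultiplierP => x y; apply: val_inj => /=.
  rewrite [LHS]nuE !csa_smulE -[csa_val (nu x)]/(csa_val (nu' x)) nu'E.
  by have /is_smultiplierP -> := muM.
have [i|a nua] := Jnu nu' nuM.
  have [W [e eAI]] := JW i; have [p [pK pM]] := Jp i.
  exact: (restr_ideal Bbai Bfact (Jideal i) W pK pM eAI nuM nu'E).
exists (csa_val a); split; first exact: csa_val_carrier.
by move=> x /carrier_csa[y <-]; rewrite -nu'E nua csa_smulE.
Qed.

Lemma sided_type_center : sided_type s A -> canonical_image A m.
Proof.
move=> [Abai /(_ mu muM)[B [Bcond Bfact muB muA]]].
have [c muc] := muA (restr_subalgebra Bcond Bfact muB).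
exists c => //; apply/esym/(scenter_mult hK Zm Abai) => f a.
by rewrite muP muc.
Qed.

Lemma sided_perp_center : type_perp (@sfactored K (~~ s) A) ->
  canonical_image A m.
Proof.
move=> [Abai [I [J [p [Jideal JW pK pM mperp]]]]].
have psM i a y : p i (smul s a (csa_val y)) = smul s (p i a) y.
  apply: val_inj => /=; rewrite [RHS]csa_smulE /smul.
  by case: s; [exact: (pM i (csa_val y) a).2|exact: (pM i (csa_val y) a).1].
have [i|c [n [nperp mE]]] := mperp m.
  have [W [e [eAI [E eE]]]] := JW i.
  (* For [f = g \o p i] the module law gives [f (a e_k) = g (p_i(a) e_k)], which tends to [f a]; so
     [scenter_cvg] applies with [phi = f]. *)
  have fm (g : dual (csa (J i))) :
      g (p i (mu (csa_val (e k)))) @[k --> \oo] --> m (adjoint (p i) g).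
    have uE k : `|csa_val (e k)| <= E by exact: eE.
    have := scenter_cvg hK _ uE Zm (F := \oo) (f := adjoint (p i) g)
      (phi := adjoint (p i) g).
    under eq_fun do rewrite muP.
    apply=> a /=; under eq_fun do rewrite psM.
    by apply: dual_cvg; have [] := is_seq_AI_smul s eAI (p i a).
  have [g|c cP] :=
    weakly_complete_limit (x := fun k => p i (mu (csa_val (e k)))) W.
    by exists (m (adjoint (p i) g)); exact: fm.
  exists c => //; apply: bidualP => g /=.
  exact: (@cvg_unique K^o) (cP g) (fm g).
exists c => //; apply/esym/(scenter_mult hK Zm Abai) => f a.
(* [n] kills every [sact (~~ s) f a], so [m] agrees there with [c]. *)
rewrite mE -[LHS]/(sact (~~ s) f a c + n (sact (~~ s) f a)).
rewrite nperp ?addr0 ?sactE ?smulN//.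
by apply/sfactoredP; exists f, a.
Qed.

End Main.

(** * The three equivalences and consequences on each side *)

Section Conclusion.
Variables (K : numFieldType) (hK : real_or_complex K) (s : bool).
Variable A : banachAlgType K.

(** The product [□] serves on both sides, as it agrees with [△] when one factor lies in [A]. *)
Definition sprod (m : bidual A) (a : bidual A) : bidual A :=
  if s then m □ a else a □ m.

Lemma sprodE m a f : sprod m (to_bidual a) f = m (sact (~~ s) f a).
Proof.
rewrite /sprod /sact; case: s => //=.
by congr (m _); exact: dualP.
Qed.

(** At each [f], the product of [a] with [n] is the value of [n] at the fixed functional [f.a] or
    [a.f], which is weak* continuous in [n]. *)
Lemma to_bidual_scenter : canonical_image A `<=` @scenter K s A.
Proof.
move=> _ [a _ <-] /=; rewrite /scenter.
have ev (n : bidual A) (g : dual A) : k g @[k --> n] --> n g.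
  exact: (@bidual_cvgP K A _ (nbhs n) (nbhs_filter n) id n).1.
case: s => n; apply/(@bidual_cvgP K A _ (nbhs n) (nbhs_filter n)) => f.
- exact: (ev n (actr f a)).
- exact: (ev n (actl a f)).
Qed.

Hypothesis typeA : sided_type s A \/ type_perp (@sfactored K (~~ s) A).

Lemma scenter_canonical m : scenter s m ->
  canonical_image A m <->
  (forall a, canonical_image A a -> canonical_image A (sprod m a)).
Proof.
move=> Zm; split=> [[c _ <-] _ [a _ <-]|mA].
  exists (smul s c a) => //; apply: bidualP => f.
  by rewrite sprodE /= sactE smulN.
have keeps : keeps_algebra s m.
  move=> a; have [|b _ bE] := mA (to_bidual a); first by exists a.
  by exists b => f; rewrite -sprodE -bE.
have [mu [muM muP]] := multiplier_of hK keeps.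
by case: typeA; [exact: (sided_type_center hK Zm muM muP)
                |exact: (sided_perp_center hK Zm muP)].
Qed.

Lemma scenter_eq_canonical :
  @scenter K s A = canonical_image A <->
  (forall m a, scenter s m -> canonical_image A a ->
    canonical_image A (sprod m a)).
Proof.
split=> [E m a Zm|ZA].
  by move: a; apply/(scenter_canonical Zm); rewrite -E.
apply/seteqP; split; last exact: to_bidual_scenter.
by move=> m Zm; apply/(scenter_canonical Zm) => a; exact: ZA.
Qed.

End Conclusion.

Theorem theorem34 (K : numFieldType) (hK : real_or_complex K)
    (A : banachAlgType K) :
  (type_LM A \/ type_LMperp A ->
    [/\ (forall m, Zl A m ->
           (canonical_image A m <-> [set m □ a | a in canonical_image A] `<=` canonical_image A)),
        (Zl A = canonical_image A <->
           [set m □ a | m in Zl A & a in canonical_image A] `<=` canonical_image A) &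
        ([set m □ a | m in [set: bidual A] & a in canonical_image A] `<=` canonical_image A ->
           Zl A = canonical_image A)])
  /\
  (type_RM A \/ type_RMperp A ->
    [/\ (forall m, Zr A m ->
           (canonical_image A m <-> [set a □ m | a in canonical_image A] `<=` canonical_image A)),
        (Zr A = canonical_image A <->
           [set a □ m | a in canonical_image A & m in Zr A] `<=` canonical_image A) &
        ([set a □ m | a in canonical_image A & m in [set: bidual A]] `<=` canonical_image A ->
           Zr A = canonical_image A)]).
Proof.
split=> typeA.
- have E : sided_type true A \/ type_perp (@sfactored K (~~ true) A) by [].
  have Zeq := @scenter_eq_canonical K hK true A E.
  split.
  + move=> m Zm; rewrite (@scenter_canonical K hK true A E m Zm); split.
      by move=> mA _ [a Aa <-]; exact: mA.
    by move=> mA a Aa; apply: mA; exists a.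
  + apply: iff_trans Zeq _; split => [ZA _ [m Zm [a Aa <-]]|ZA m a Zm Aa].
      exact: ZA.
    by apply: ZA; exists m => //; exists a.
  + move=> AA; apply/Zeq => m a _ Aa.
    by apply: AA; exists m => //; exists a.
- have E : sided_type false A \/ type_perp (@sfactored K (~~ false) A) by [].
  have Zeq := @scenter_eq_canonical K hK false A E.
  split.
  + move=> m Zm; rewrite (@scenter_canonical K hK false A E m Zm); split.
      by move=> mA _ [a Aa <-]; exact: mA.
    by move=> mA a Aa; apply: mA; exists a.
  + apply: iff_trans Zeq _; split => [ZA _ [a Aa [m Zm <-]]|ZA m a Zm Aa].
      exact: ZA.
    by apply: ZA; exists a => //; exists m.
  + move=> AA; apply/Zeq => m a _ Aa.
    by apply: AA; exists a => //; exists m.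
Qed.
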